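(* Let $$H(q)=(1-q)(1-q^4)(1-q^5)\prod_{m\ge 1}\frac{1-q^{e(m)}}{1-q^m}=\sum_{n\ge 0}h(n)q^n,$$ where $e(m)=m(\nu_2(m)+2)$, and set $\mathcal{R}=\mathcal{O}_1\cup\mathcal{O}_4\cup\mathcal{O}_5$, where $\mathcal{O}_s$ is the forward orbit of $s$ under $e$. Then $$H(q)=\prod_{m\ge 1,\ m\notin\mathcal{R}}\bigl(1+q^m+q^{2m}+\cdots+q^{(\nu_2(m)+1)m}\bigr)\in\mathbb{N}[[q]].$$ Moreover $h(0)=h(3)=1$, while $h(1)=h(2)=h(4)=h(5)=h(6)=0$, and $h(n)>0$ for every $n\ge 7$.
   Context: All series are formal power series in $q$; $\mathbb{N}$ includes $0$, and $\mathbb{N}[[q]]$ is the set of formal power series with nonnegative integer coefficients. For a positive integer $m$, $\nu_2(m)=\max\{a\ge 0:2^a\mid m\}$ is the $2$-adic valuation. The map $e$ on positive integers is $e(m)=m(\nu_2(m)+2)$; its iterates are $e^{(0)}(s)=s$, $e^{(r+1)}(s)=e(e^{(r)}(s))$ for $r\ge 0$, and $\mathcal{O}_s=\{e^{(r)}(s):r\ge 0\}$ is the forward orbit of $s\ge 1$. *)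

(* Defs.v *)
From HB Require Import structures.
From mathcomp Require Import all_boot all_order all_algebra.
From mathcomp Require Import boolp classical_sets.

Set Implicit Arguments.
Unset Strict Implicit.
Unset Printing Implicit Defensive.

Import GRing.Theory.
Local Open Scope ring_scope.

Record fps (R : Type) := FPS { fcoef : nat -> R }.
Notation "{ 'fps' R }" := (fps R) (at level 0, format "{ 'fps'  R }").

HB.instance Definition _ (R : Type) := gen_eqMixin {fps R}.
HB.instance Definition _ (R : Type) := gen_choiceMixin {fps R}.

Lemma fpsP (R : Type) (f g : {fps R}) :
  (forall n, fcoef f n = fcoef g n) -> f = g.
Proof. by case: f g => [f] [g] /= fg; congr FPS; apply/funext. Qed.

Section Zmodule.
Variable R : zmodType.
Implicit Types f g h : {fps R}.

Definition fps_zero : {fps R} := FPS (fun=> 0).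
Definition fps_opp f : {fps R} := FPS (fun n => - fcoef f n).
Definition fps_add f g : {fps R} := FPS (fun n => fcoef f n + fcoef g n).

Fact fps_addA : associative fps_add.
Proof. by move=> f g h; apply: fpsP => n /=; rewrite addrA. Qed.
Fact fps_addC : commutative fps_add.
Proof. by move=> f g; apply: fpsP => n /=; rewrite addrC. Qed.
Fact fps_add0 : left_id fps_zero fps_add.
Proof. by move=> f; apply: fpsP => n /=; rewrite add0r. Qed.
Fact fps_addN : left_inverse fps_zero fps_opp fps_add.
Proof. by move=> f; apply: fpsP => n /=; rewrite addNr. Qed.

HB.instance Definition _ :=
  GRing.isZmodule.Build {fps R} fps_addA fps_addC fps_add0 fps_addN.
End Zmodule.

Section Ring.
Variable R : comNzRingType.
Implicit Types f g h : {fps R}.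

Definition fps_one : {fps R} := FPS (fun n => (n == 0%N)%:R).
Definition fps_mul f g : {fps R} :=
  FPS (fun n => \sum_(j < n.+1) fcoef f j * fcoef g (n - j)).

Let trunc f n : {poly R} := \poly_(i < n.+1) fcoef f i.

Let coef_trunc f n i : (i <= n)%N -> (trunc f n)`_i = fcoef f i.
Proof. by move=> le_in; rewrite coef_poly ltnS le_in. Qed.

Let fcoefM f g n i : (i <= n)%N ->
  fcoef (fps_mul f g) i = (trunc f n * trunc g n)`_i.
Proof.
move=> le_in; rewrite coefM; apply: eq_bigr => j _ /=.
rewrite !coef_trunc //; first exact: leq_trans (leq_subr _ _) le_in.
by apply: leq_trans le_in; rewrite -ltnS.
Qed.

Fact fps_mulA : associative fps_mul.
Proof.
move=> f g h; apply: fpsP => n.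
transitivity ((trunc f n * (trunc g n * trunc h n))`_n).
  rewrite coefM; apply: eq_bigr => j _.
  rewrite -fcoefM ?leq_subr // coef_trunc //.
  by rewrite -ltnS.
rewrite mulrA coefM; apply: eq_bigr => j _.
by rewrite -fcoefM -1?ltnS // coef_trunc ?leq_subr.
Qed.

Fact fps_mulC : commutative fps_mul.
Proof. by move=> f g; apply: fpsP => n; rewrite !(fcoefM _ _ (leqnn n)) mulrC. Qed.

Fact fps_mul1 : left_id fps_one fps_mul.
Proof.
move=> f; apply: fpsP => n /=.
rewrite big_ord_recl /= mul1r subn0 big1 ?addr0 // => j _.
by rewrite mul0r.
Qed.

Fact fps_mulDl : left_distributive fps_mul (@fps_add R).
Proof.
move=> f g h; apply: fpsP => n /=; rewrite -big_split.
by apply: eq_bigr => j _; rewrite mulrDl.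
Qed.

Fact fps_oner_neq0 : fps_one != 0 :> {fps R}.
Proof.
apply/eqP => /(congr1 (fun f : {fps R} => fcoef f 0)) /=.
by move/eqP; rewrite oner_eq0.
Qed.

HB.instance Definition _ := GRing.Zmodule_isComNzRing.Build {fps R}
  fps_mulA fps_mulC fps_mul1 fps_mulDl fps_oner_neq0.

Definition fpsX : {fps R} := FPS (fun n => (n == 1%N)%:R).
End Ring.

Section UnitRing.
Variable R : comUnitRingType.
Implicit Types f g : {fps R}.

(* The first n coefficients of 1 / f, solving f * g = 1 degree by degree. *)
Fixpoint fps_inv_seq f (n : nat) : seq R :=
  if n is m.+1 then
    let s := fps_inv_seq f m in
    rcons s ((fcoef f 0)^-1 *
             ((m == 0%N)%:R - \sum_(j < m) fcoef f (m - j) * s`_j))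
  else [::].

Definition fps_unit : pred {fps R} :=
  fun f => fcoef f 0 \is a GRing.unit.
Definition fps_inv f : {fps R} :=
  if fps_unit f then FPS (fun n => (fps_inv_seq f n.+1)`_n) else f.

Let size_inv_seq f n : size (fps_inv_seq f n) = n.
Proof. by elim: n => //= n IHn; rewrite size_rcons IHn. Qed.

Let nth_inv_seq f n i : (i < n)%N ->
  (fps_inv_seq f n)`_i = (fps_inv_seq f i.+1)`_i.
Proof.
elim: n => // n IHn; rewrite ltnS leq_eqVlt => /predU1P[->//|lt_in].
by rewrite [LHS]/= nth_rcons size_inv_seq lt_in IHn.
Qed.

Fact fps_mulVr : {in fps_unit, left_inverse 1 fps_inv *%R}.
Proof.
move=> f Uf; rewrite /fps_inv (Uf : fps_unit f); apply: fpsP => n.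
rewrite [LHS]/= big_ord_recr subnn.
rewrite nth_rcons size_inv_seq ltnn eqxx mulrAC mulVr // mul1r /=.
rewrite addrC -addrA [X in _ + X](_ : _ = 0) ?addr0 //.
apply/eqP; rewrite addrC subr_eq0; apply/eqP/eq_bigr => j _.
by rewrite mulrC [in RHS]nth_inv_seq.
Qed.

Fact fps_unitPl f g : g * f = 1 -> fps_unit f.
Proof.
move/(congr1 (fun h : {fps R} => fcoef h 0)) => /=.
by rewrite big_ord1 => gf1; apply/unitrPr; exists (fcoef g 0); rewrite mulrC.
Qed.

Fact fps_invr_out : {in [predC fps_unit], fps_inv =1 id}.
Proof. by move=> f /negbTE Uf; rewrite /fps_inv [fps_unit f]Uf. Qed.

HB.instance Definition _ := GRing.ComNzRing_hasMulInverse.Build {fps R}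
  fps_mulVr fps_unitPl fps_invr_out.
End UnitRing.

Section InfiniteProduct.
Variable R : comNzRingType.

(* Convergence in the product topology on R^nat with R discrete. *)
Definition fps_cvg_to (u : nat -> {fps R}) (l : {fps R}) : Prop :=
  forall n, exists N, forall k, (N <= k)%N -> fcoef (u k) n = fcoef l n.

Lemma fps_cvg_to_unique u l l' : fps_cvg_to u l -> fps_cvg_to u l' -> l = l'.
Proof.
move=> ul ul'; apply: fpsP => n; have [N uN] := ul n; have [N' uN'] := ul' n.
by rewrite -(uN _ (leq_maxl N N')) uN' // leq_maxr.
Qed.

(* Products range over the positive integers satisfying P. *)
Definition partial_prod (P : pred nat) (F : nat -> {fps R}) (N : nat) :
    {fps R} :=
  \prod_(1 <= m < N | P m) F m.

Definition multipliable (P : pred nat) (F : nat -> {fps R}) : Prop :=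
  exists l, fps_cvg_to (partial_prod P F) l.

(* Junk value 0 when the partial products do not converge. *)
Definition infprod (P : pred nat) (F : nat -> {fps R}) : {fps R} :=
  xget 0 [set l | fps_cvg_to (partial_prod P F) l]%classic.
End InfiniteProduct.

Definition nonneg_fps : set {fps int} :=
  [set f | forall n, (0 <= fcoef f n)%R]%classic.

Definition e (m : nat) : nat := (m * (logn 2 m + 2))%N.

Definition e_orbit (s : nat) : set nat :=
  [set m | exists r, m = iter r e s]%classic.

Definition Rset : set nat := (e_orbit 1 `|` e_orbit 4 `|` e_orbit 5)%classic.

Definition q : {fps int} := fpsX int.

Definition H_factor (m : nat) : {fps int} := (1 - q ^+ e m) / (1 - q ^+ m).

Definition H : {fps int} :=
  (1 - q) * (1 - q ^+ 4) * (1 - q ^+ 5) * infprod xpredT H_factor.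

Definition geometric_factor (m : nat) : {fps int} :=
  \sum_(0 <= k < (logn 2 m).+2) q ^+ (k * m).

Definition h (n : nat) : int := fcoef H n.

(* Main.v *)
Require Import Defs.
From mathcomp Require Import all_boot all_order all_algebra.
From mathcomp Require Import boolp classical_sets.
From mathcomp Require Import zify ring.

Set Implicit Arguments.
Unset Strict Implicit.
Unset Printing Implicit Defensive.

(* Since (1 - q^(e m)) / (1 - q^m) is the geometric factor of m, the product
   over an orbit O_s telescopes to 1 / (1 - q^s).  The orbits of 1, 4 and 5 are
   pairwise disjoint, so the prefactors of H cancel exactly the factors indexed
   by R.  Positivity: the only odd elements of R are 1 and 5, hence for n >= 7
   either n itself is outside R, or n is even, n <> 8, and n = 3 + (n - 3) is
   a sum of two distinct integers outside R. *)

Local Open Scope ring_scope.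
Import Order.TTheory GRing.Theory Num.Theory.

(** * Congruence modulo powers of [q] and convergence of infinite products *)

Section Truncation.
Variable R : comNzRingType.
Implicit Types (f g : {fps R}) (F : nat -> {fps R}) (P Q : pred nat).

Definition fps_eqmod (n : nat) f g : Prop :=
  forall i, (i < n)%N -> fcoef f i = fcoef g i.

Lemma fps_eqmodW {m n f g} : (m <= n)%N -> fps_eqmod n f g -> fps_eqmod m f g.
Proof. by move=> mn fg i im; apply: fg; apply: leq_trans mn. Qed.

Lemma fps_eqmodM n f f' g g' :
  fps_eqmod n f f' -> fps_eqmod n g g' -> fps_eqmod n (f * g) (f' * g').
Proof.
move=> ff gg i lt_in; apply: eq_bigr => -[j /= lt_ji] _.
by rewrite ff ?gg //; lia.
Qed.

Lemma fcoefM0 f g : fcoef (f * g) 0 = fcoef f 0 * fcoef g 0.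
Proof. by rewrite /= big_ord1. Qed.

Lemma fcoef_sum (I : Type) (r : seq I) (G : I -> {fps R}) n :
  fcoef (\sum_(i <- r) G i) n = \sum_(i <- r) fcoef (G i) n.
Proof. by elim/big_rec2: _ => //= i x y _ ->. Qed.

Lemma fcoefXn k n : fcoef (fpsX R ^+ k) n = (n == k)%:R.
Proof.
elim: k n => [|k IHk] [|n]; rewrite ?expr0 // exprS.
  by rewrite fcoefM0 /= mul0r.
rewrite /= 2!big_ord_recl big1 => [|i _]; last by rewrite /= mul0r.
by rewrite /= mul0r add0r mul1r addr0 subn1 /= IHk eqSS.
Qed.

Lemma fps_eqmod_1subXn {n k} : (n <= k)%N -> fps_eqmod n (1 - fpsX R ^+ k) 1.
Proof.
move=> nk i lt_in /=; rewrite fcoefXn.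
by rewrite (ltn_eqF (leq_trans lt_in nk)) subr0.
Qed.

(** The factor of index [m] can only affect coefficients of degree at least [m]. This makes
    coefficient [n] of the partial products constant once the factors of index up to [n] are
    included. *)
Definition tends_to_1 F : Prop :=
  forall m, (0 < m)%N -> fps_eqmod m (F m) 1.

Lemma partial_prod_stable {P F n N} : tends_to_1 F -> (0 < n <= N)%N ->
  fps_eqmod n (partial_prod P F N) (partial_prod P F n).
Proof.
move=> F1 /andP[n0 nN]; rewrite /partial_prod (big_cat_nat _ nN) //=.
rewrite -[X in fps_eqmod n _ X]mulr1; apply: fps_eqmodM => //.
rewrite big_nat_cond.
apply: (big_ind (fun f => fps_eqmod n f 1)) => // [f g f1 g1|].
  by rewrite -[X in fps_eqmod n _ X]mulr1; apply: fps_eqmodM.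
move=> i /andP[/andP[ni _] _].
exact: fps_eqmodW ni (F1 _ (leq_trans n0 ni)).
Qed.

Lemma multipliable_tends_to_1 P F : tends_to_1 F -> multipliable P F.
Proof.
move=> F1; exists (FPS (fun n => fcoef (partial_prod P F n.+1) n)) => n.
by exists n.+1 => k nk; apply: (partial_prod_stable F1).
Qed.

Lemma fcoef_infprod P F n N : tends_to_1 F -> (n < N)%N ->
  fcoef (infprod P F) n = fcoef (partial_prod P F N) n.
Proof.
move=> F1 nN.
have [l Fl] := multipliable_tends_to_1 P F1.
(* A limit exists, so [xget] returns one of them and not its default value 0. *)
have /(_ n)[K FK] : fps_cvg_to (partial_prod P F) (infprod P F).
  exact: (@xgetPex _ 0 [set l | fps_cvg_to (partial_prod P F) l]%classic
    (ex_intro _ l Fl)).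
rewrite -(FK (maxn K N)) ?leq_maxl //.
apply: (partial_prod_stable F1 _ nN).
by rewrite leq_maxr andbT; apply: leq_ltn_trans nN.
Qed.

Lemma fps_eqmod_infprod P F N : tends_to_1 F ->
  fps_eqmod N (infprod P F) (partial_prod P F N).
Proof. by move=> F1 i; apply: fcoef_infprod. Qed.

Lemma partial_prodU P Q F N : (forall m, ~~ (P m && Q m)) ->
  partial_prod (predU P Q) F N = partial_prod P F N * partial_prod Q F N.
Proof.
move=> PQ; rewrite /partial_prod !(big_mkcond _ F) -big_split /=.
apply: eq_bigr => m _; have := PQ m.
by case: (P m); case: (Q m) => //= _; rewrite ?mul1r ?mulr1.
Qed.

End Truncation.

(** * The geometric factors *)

(** A finite geometric sum in [q ^+ m] with [logn 2 m + 2] terms, which is exactly the multiplier in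
    [e m]. It is the single step of the telescoping along an orbit. *)
Lemma geometric_factorE m :
  (1 - q ^+ m) * geometric_factor m = 1 - q ^+ e m.
Proof.
rewrite /geometric_factor big_mkord /e addn2 exprM -[RHS]opprB subrX1 -mulNr.
rewrite opprB; congr (_ * _).
by apply: eq_bigr => i _; rewrite -exprM mulnC.
Qed.

Lemma H_factorE m : (0 < m)%N -> H_factor m = geometric_factor m.
Proof.
move=> m0; have U : 1 - q ^+ m \is a GRing.unit.
  by rewrite unfold_in /= /fps_unit (fps_eqmod_1subXn _ m0) //= unitr1.
by rewrite /H_factor -geometric_factorE mulrC mulKr.
Qed.

Lemma fcoef_geometric_factor m i :
  fcoef (geometric_factor m) i =
  \sum_(0 <= k < (logn 2 m).+2) (i == k * m)%N%:R.
Proof. by rewrite fcoef_sum; apply: eq_bigr => k _; rewrite fcoefXn. Qed.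

Lemma geometric_factor_tends_to_1 : tends_to_1 geometric_factor.
Proof.
move=> m m0 i im; rewrite fcoef_geometric_factor big_ltn // mul0n.
rewrite big_nat big1 ?addr0 // => k /andP[k0 _].
suff /negbTE-> : (i != k * m)%N by [].
by rewrite neq_ltn (leq_trans im) // leq_pmull.
Qed.

Lemma geometric_factor_nonneg m : nonneg_fps (geometric_factor m).
Proof.
by move=> i; rewrite fcoef_geometric_factor; apply: sumr_ge0.
Qed.

Lemma fcoef_geometric_factor_gt0 m : (0 < m)%N ->
  0 < fcoef (geometric_factor m) m.
Proof.
move=> m0; rewrite fcoef_geometric_factor 2?big_ltn // mul1n eqxx.
by rewrite addrCA ltr_wpDr // addr_ge0 // sumr_ge0.
Qed.

(** * Nonnegative and positive coefficients of products *)

Lemma nonneg_fpsM f g : nonneg_fps f -> nonneg_fps g -> nonneg_fps (f * g).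
Proof. by move=> f0 g0 n; apply: sumr_ge0 => j _; apply: mulr_ge0. Qed.

Lemma nonneg_fps_prod (r : seq nat) (P : pred nat) F :
  (forall m, nonneg_fps (F m)) -> nonneg_fps (\prod_(m <- r | P m) F m).
Proof.
move=> F0; apply: (big_ind (fun f => nonneg_fps f)) => //.
exact: nonneg_fpsM.
Qed.

Lemma fcoefM_gt0 (f g : {fps int}) i j : nonneg_fps f -> nonneg_fps g ->
  0 < fcoef f i -> 0 < fcoef g j -> 0 < fcoef (f * g) (i + j).
Proof.
move=> f0 g0 fi gj; rewrite /= (bigD1 (inord i)) //= inordK; last by lia.
rewrite addKn ltr_wpDr ?mulr_gt0 //.
by apply: sumr_ge0 => k _; apply: mulr_ge0.
Qed.

Lemma fcoef0_prod_geometric (r : seq nat) (P : pred nat) :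
  (forall m, m \in r -> 0 < m)%N ->
  0 < fcoef (\prod_(m <- r | P m) geometric_factor m) 0.
Proof.
move=> r0; rewrite big_seq_cond.
apply: (big_ind (fun f => 0 < fcoef f 0)) => //
    [f g f0 g0|m /andP[/r0 m0 _]].
  by rewrite fcoefM0 mulr_gt0.
by rewrite geometric_factor_tends_to_1.
Qed.

(** Take the term [q ^+ m] from the factor of each [m] in [s] and the term 1 from every other
    factor. All coefficients are nonnegative, so this contribution cannot cancel. *)
Lemma partial_prod_geometric_gt0 (P : pred nat) (s : seq nat) N :
  uniq s -> all (fun m => (0 < m < N)%N && P m) s ->
  0 < fcoef (partial_prod P geometric_factor N) (sumn s).
Proof.
move=> Us /allP sP.
(* The factors indexed by [s] supply degree [sumn s]; the remaining ones supply degree 0. *)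
rewrite /partial_prod (bigID (mem s)) /= -[sumn s]addn0.
apply: fcoefM_gt0; try exact/nonneg_fps_prod/geometric_factor_nonneg.
  rewrite -big_filter (perm_big s) /=; last first.
    apply: uniq_perm => // [|m]; first by rewrite filter_uniq ?iota_uniq.
    rewrite mem_filter mem_index_iota.
    apply/andP/idP => [[/andP[]]//|ms].
    by have /andP[-> ->] := sP _ ms.
  have {}sP m : m \in s -> (0 < m)%N by move=> /sP/andP[/andP[]].
  elim: s {Us} sP => [|m s IHs] sP; first by rewrite big_nil.
  rewrite big_cons; apply: fcoefM_gt0.
  - exact: geometric_factor_nonneg.
  - exact/nonneg_fps_prod/geometric_factor_nonneg.
  - by apply: fcoef_geometric_factor_gt0; apply: sP; rewrite mem_head.
  - by apply: IHs => k ks; apply: sP; rewrite inE ks orbT.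
by apply: fcoef0_prod_geometric => m; rewrite mem_index_iota => /andP[].
Qed.

(** * Orbits of [e] and telescoping *)

Lemma e_gt m : (0 < m)%N -> (m < e m)%N.
Proof. by rewrite /e => m0; rewrite ltn_Pmulr // addn2. Qed.

Lemma iter_e_gt0 r s : (0 < s)%N -> (0 < iter r e s)%N.
Proof. by move=> s0; elim: r => //= r IHr; apply: ltn_trans IHr (e_gt IHr). Qed.

Lemma leq_iter_e s r r' : (0 < s)%N -> (r <= r')%N ->
  (iter r e s <= iter r' e s)%N.
Proof.
move=> s0 /subnK <-; rewrite iterD; elim: (r' - r)%N => //= k IHk.
by apply: leq_trans IHk (ltnW (e_gt _)); rewrite -iterD iter_e_gt0.
Qed.

Lemma partial_prod_orbit s N : (0 < s)%N -> (0 < N)%N ->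
  fps_eqmod N
    ((1 - q ^+ s) * partial_prod (fun m => m \in e_orbit s) geometric_factor N)
    1.
Proof.
move=> s0 N0.
(* An exact identity is proved by induction on [N]: [r] is the number of orbit elements below [N],
   so [iter r e s] is the first iterate that has not yet contributed, and [1 - q ^+ iter r e s] is 1
   modulo [q ^+ N]. *)
suff [r [_ Nr ->]] : exists r,
    [/\ forall r', (r' < r)%N -> (iter r' e s < N)%N,
        (N <= iter r e s)%N &
        (1 - q ^+ s) *
        partial_prod (fun m => m \in e_orbit s) geometric_factor N =
        1 - q ^+ iter r e s].
  exact: fps_eqmod_1subXn.
elim: N N0 => // -[_ _|N /(_ isT)[r [ltr ler E]] _].
  by exists 0%N; split=> //; rewrite /partial_prod big_geq ?mulr1.
rewrite /partial_prod big_mkcond big_nat_recr //= -big_mkcond /= mulrA.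
rewrite -[\prod_(_ <= _ < _ | _) _]/(partial_prod _ _ _) E.
(* The new index [N.+1] either is the next iterate [iter r e s], and one more telescoping step
   applies, or lies outside the orbit, and [r] is kept. *)
have [|NO] := boolP (N.+1 \in e_orbit s).
  rewrite inE => -[r' Nr'].
  have rr' : (r <= r')%N.
    by rewrite leqNgt; apply/negP => /ltr; rewrite -Nr' ltnn.
  have {r' rr' Nr'} Nr : N.+1 = iter r e s.
    by apply/eqP; rewrite eqn_leq ler [X in (_ <= X)%N]Nr' leq_iter_e.
  exists r.+1; split => [r'||]; rewrite /= -?Nr ?geometric_factorE //.
  - rewrite ltnS => /(leq_iter_e s0).
    by rewrite -Nr.
  - exact: e_gt.
exists r; split=> [r' /ltr|  |]; rewrite ?mulr1 //.
  exact: leqW.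
rewrite ltn_neqAle ler andbT; apply: contra NO => /eqP Nr.
by rewrite inE; exists r.
Qed.

Lemma e_orbit_ind (Q : nat -> Prop) s : Q s -> (forall m, Q m -> Q (e m)) ->
  forall m, m \in e_orbit s -> Q m.
Proof. by move=> Qs Qe m; rewrite inE => -[r ->]; elim: r => //= r /Qe. Qed.

(** Such an [m] is twice an odd number, so its valuation is 1. Tripling preserves both the residue 2
    modulo 4 and divisibility or not by 5, which yields invariants for the orbits of 1 and 5. *)
Lemma e_mod4_2 m : (m %% 4 = 2)%N -> e m = (3 * m)%N.
Proof.
move=> m4; rewrite /e mulnC.
have -> : m = (2 * (m %/ 4 * 2).+1)%N by lia.
by rewrite lognM // (@logn_prime 2 2) // lognE /= dvdn2 /= oddM andbF.
Qed.

(** After its starting point the orbit of 1 goes through 2, that of 4 through 16 and that of 5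
    through 10. The invariants in this lemma and the next two make the orbits pairwise disjoint:
    residues modulo 4 set the orbit of 4 apart, and divisibility by 5 separates the other two. *)
Lemma e_orbit1 m : m \in e_orbit 1 ->
  m = 1%N \/ (m %% 4 = 2)%N /\ ~~ (5 %| m)%N.
Proof.
move: m; apply: e_orbit_ind; first by left.
move=> m [->|[m4 m5]]; right; first by vm_compute.
by rewrite e_mod4_2 // Gauss_dvdr //; split=> //; lia.
Qed.

Lemma e_orbit4 m : m \in e_orbit 4 -> m = 4%N \/ (16 %| m)%N.
Proof.
move: m; apply: e_orbit_ind; first by left.
by move=> m [->|m16]; right; [vm_compute|rewrite /e dvdn_mulr].
Qed.

Lemma e_orbit5 m : m \in e_orbit 5 -> m = 5%N \/ (m %% 4 = 2)%N /\ (5 %| m)%N.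
Proof.
move: m; apply: e_orbit_ind; first by left.
move=> m [->|[m4 m5]]; right; first by vm_compute.
by rewrite e_mod4_2 // dvdn_mull //; split=> //; lia.
Qed.

Lemma in_Rset m : (m \in Rset) =
  [|| m \in e_orbit 1, m \in e_orbit 4 | m \in e_orbit 5].
Proof. by rewrite /Rset !in_setU orbA. Qed.

Lemma odd_notin_Rset m : odd m -> m != 1%N -> m != 5%N -> m \notin Rset.
Proof.
move=> mo m1 m5; rewrite in_Rset; apply/negP.
by case/or3P => [/e_orbit1|/e_orbit4|/e_orbit5]; lia.
Qed.

(** Needed because the splitting [n = 3 + (n - 3)] fails at 8, where [n - 3] is 5, an element of
    [Rset]. *)
Lemma notin_Rset_8 : 8%N \notin Rset.
Proof.
rewrite in_Rset; apply/negP.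
by case/or3P => [/e_orbit1|/e_orbit4|/e_orbit5]; lia.
Qed.

Lemma partial_prod_Rset N : (0 < N)%N ->
  fps_eqmod N
    ((1 - q) * (1 - q ^+ 4) * (1 - q ^+ 5) *
     partial_prod (fun m => m \in Rset) geometric_factor N) 1.
Proof.
move=> N0; set P := fun s m => m \in e_orbit s.
have -> : partial_prod (fun m => m \in Rset) geometric_factor N =
    partial_prod (P 1%N) geometric_factor N *
    (partial_prod (P 4) geometric_factor N *
     partial_prod (P 5) geometric_factor N).
  rewrite -!partial_prodU.
  - by apply: eq_bigl => m; rewrite in_Rset.
  - move=> m; rewrite /P /=; apply/negP => /andP[/e_orbit1 ?].
    by case/orP => [/e_orbit4|/e_orbit5]; lia.
  - by move=> m; rewrite /P; apply/negP => /andP[/e_orbit4 ? /e_orbit5]; lia.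
have := fps_eqmodM (partial_prod_orbit (isT : 0 < 1)%N N0)
  (fps_eqmodM (partial_prod_orbit (isT : 0 < 4)%N N0)
              (partial_prod_orbit (isT : 0 < 5)%N N0)).
rewrite !mul1r expr1 /P; congr fps_eqmod; ring.
Qed.

Lemma H_factor_tends_to_1 : tends_to_1 H_factor.
Proof.
by move=> m m0; rewrite H_factorE //; apply: geometric_factor_tends_to_1.
Qed.

(** * The product formula for [H] and its coefficients *)

Lemma fps_eqmod_H N : (0 < N)%N ->
  fps_eqmod N H (partial_prod (fun m => m \notin Rset) geometric_factor N).
Proof.
move=> N0 i lt_iN.
have -> : fcoef H i = fcoef ((1 - q) * (1 - q ^+ 4) * (1 - q ^+ 5) *
    partial_prod xpredT geometric_factor N) i.
  apply: fps_eqmodM lt_iN => // j lt_jN.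
  rewrite (fps_eqmod_infprod _ H_factor_tends_to_1 lt_jN).
  congr fcoef; apply: eq_big_nat => m /andP[m0 _]; exact: H_factorE.
(* The factors indexed by [Rset] are grouped with the three prefactors; together they are 1 modulo
   [q ^+ N]. *)
rewrite {1}/partial_prod (bigID (fun m => m \in Rset)) mulrA.
rewrite -[RHS](congr1 (fun f => fcoef f i) (mul1r _)).
by apply: fps_eqmodM lt_iN => //; apply: partial_prod_Rset.
Qed.

Lemma fcoef_H n N : (n < N)%N ->
  h n = fcoef (partial_prod (fun m => m \notin Rset) geometric_factor N) n.
Proof. by move=> nN; apply: fps_eqmod_H => //; apply: leq_ltn_trans nN. Qed.

Lemma h_gt0 (s : seq nat) : uniq s ->
  all (fun m => (0 < m)%N && (m \notin Rset)) s -> 0 < h (sumn s).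
Proof.
move=> Us sP; rewrite (fcoef_H (ltnSn _)).
apply: partial_prod_geometric_gt0 => //; apply/allP => m ms.
have /andP[m0 ->] := allP sP _ ms.
by rewrite m0 ltnS andbT (perm_sumn (perm_to_rem ms)) leq_addr.
Qed.

Lemma iter_e_Rset s r : s \in [:: 1; 4; 5]%N -> iter r e s \in Rset.
Proof.
rewrite !inE => /or3P[]/eqP->; rewrite /Rset.
- by left; left; exists r.
- by left; right; exists r.
- by right; exists r.
Qed.

(** Among 1 to 6 only 3 lies outside [Rset]: 1, 2 and 6 are the first iterates from 1, while 4 and 5
    are starting points. Hence [H] agrees with the factor of 3, namely [1 + q ^+ 3], below degree
    7. *)
Lemma h_small n : (n < 7)%N -> h n = (n == 0)%N%:R + (n == 3)%N%:R.
Proof.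
move=> n7; rewrite (fcoef_H n7).
have -> : partial_prod (fun m => m \notin Rset) geometric_factor 7 =
    geometric_factor 3.
  rewrite /partial_prod big_mkcond (bigD1_seq 3%N) ?iota_uniq //=.
  rewrite odd_notin_Rset // big1_seq ?mulr1 // => m /andP[m3].
  rewrite !inE (negbTE m3) /= if_neg => m16; suff -> : m \in Rset by [].
  case/or4P: m16 => [|||/orP[]] /eqP->.
  - exact: (iter_e_Rset 0 (s := 1)).
  - exact: (iter_e_Rset 1 (s := 1)).
  - exact: (iter_e_Rset 0 (s := 4)).
  - exact: (iter_e_Rset 0 (s := 5)).
  - exact: (iter_e_Rset 2 (s := 1)).
rewrite fcoef_geometric_factor (_ : logn 2 3 = 0)%N //.
by rewrite big_ltn // big_nat1 mul0n mul1n.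
Qed.

Theorem lemma2 :
  [/\ multipliable xpredT H_factor,
      multipliable (fun m => m \notin Rset) geometric_factor,
      H = infprod (fun m => m \notin Rset) geometric_factor &
      nonneg_fps H]
  /\ [/\ h 0 = 1 /\ h 3 = 1,
         [/\ h 1 = 0, h 2 = 0, h 4 = 0, h 5 = 0 & h 6 = 0] &
         forall n : nat, (7 <= n)%N -> 0 < h n].
Proof.
split; split.
- exact: multipliable_tends_to_1 H_factor_tends_to_1.
- exact: multipliable_tends_to_1 geometric_factor_tends_to_1.
- apply: fpsP => n; rewrite [LHS](fcoef_H (ltnSn n)).
  by rewrite (fcoef_infprod _ geometric_factor_tends_to_1 (ltnSn n)).
- move=> n; rewrite [fcoef H n](fcoef_H (ltnSn n)).
  exact/nonneg_fps_prod/geometric_factor_nonneg.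
- by rewrite !h_small.
- by rewrite !h_small.
move=> n n7; have [nR|nR] := boolP (n \in Rset).
  (* An [n] of at least 7 in [Rset] is even, since 1 and 5 are its only odd elements. *)
  have odd_n3 : odd (n - 3).
    have : ~~ odd n.
      by apply: contraL nR => no; apply: odd_notin_Rset => //; lia.
    lia.
  have n8 : (n != 8)%N by apply: contraL nR => /eqP->; apply: notin_Rset_8.
  (* The odd number [n - 3] is neither 1 nor 3 because [n] is at least 7, and not 5 because [n] is
     not 8. So the two parts are distinct and both lie outside [Rset]. *)
  have -> : n = sumn [:: 3; n - 3]%N by rewrite /=; lia.
  apply: h_gt0 => /=; first by rewrite inE andbT; lia.
  by rewrite !odd_notin_Rset //; lia.
have -> : n = sumn [:: n] by rewrite /= addn0.
by apply: h_gt0 => //=; rewrite nR andbT; lia.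
Qed.
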